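(* Let $D,E$ be operators, $\langle W|$ a row vector and $|V\rangle$ a column vector satisfying $$DE-qED=D+E,\qquad \langle W|E=\langle W|,\qquad D|V\rangle=|V\rangle,\qquad \langle W|V\rangle=1 .$$ Then for every integer $n>0$, $$ \langle W| (yD+E)^{n-1} |V\rangle = \frac 1{y(1-q)^n} \sum_{k=0}^n (-1)^k \left(\sum_{j=0}^{n-k} y^j\left( \binom{n}{j}\binom{n}{j+k} - \binom{n}{j-1}\binom{n}{j+k+1}\right)\right) \left(\sum_{i=0}^k y^iq^{i(k+1-i)} \right). $$
   Context: $q$ and $y$ are commuting indeterminates (scalars). $D,E$ are linear operators on a vector space over a field containing $\mathbb{Q}(q,y)$ (for instance, suitable infinite matrices), $|V\rangle$ is a vector of that space, and $\langle W|$ is a linear functional on it; $\langle W|X|V\rangle$ denotes the resulting scalar. Binomial coefficients $\binom{n}{k}$ with $n\ge 0$ are $0$ unless $0\le k\le n$. *)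

(* Defs.v *)
(* MathComp *)
From mathcomp Require Import all_boot all_order all_algebra.

Set Implicit Arguments.
Unset Strict Implicit.
Unset Printing Implicit Defensive.

Import GRing.Theory.
Local Open Scope ring_scope.

(* The field Q(q, y), as the fraction field of Q[q][y]. *)
Definition ratfun_qy : fieldType := {fraction {poly {poly rat}}}.

Definition indet_q : ratfun_qy := tofrac ('X%:P : {poly {poly rat}}).
Definition indet_y : ratfun_qy := tofrac ('X : {poly {poly rat}}).

(* The lower index is an integer because k = -1 occurs: it must give 0,
   whereas 'C(n, j.-1) would give 1 at j = 0. *)
Definition binz (n : nat) (k : int) : nat :=
  if k is Posz m then 'C(n, m) else 0%N.

(* Main.v *)
Require Import Defs.
From HB Require Import structures.
From mathcomp Require Import all_boot all_order all_algebra.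
From mathcomp Require Import ring zify.

Set Implicit Arguments.
Unset Strict Implicit.
Unset Printing Implicit Defensive.

Import GRing.Theory.
Local Open Scope ring_scope.

(** Why the formula holds.

    Put x = (1 - q)(yD + E), d = (1 - q)D - 1 and e = (1 - q)E - 1.  The
    relations become d e - q e d = 1 - q and <W| e = -q <W|, and
    x = (1 + y) + y d + e.

    Let p_k(x) be the Chebyshev-like polynomials given by p_0 = 1, p_(-1) = 0
    and x p_k = p_(k+1) + (1 + y) p_k + y p_(k-1).  The expansion of x^n on them
    counts Motzkin paths that end at height k, with the weights of that
    recurrence.  Such a path is a pair of non-crossing binomial paths, so the
    coefficient is the sum of differences of products of binomial coefficients
    in the theorem ([ballotS], [iter_ballot]).

    It remains to evaluate the p_k, which is easy between <W| and a vacuum v0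
    killed by D.  The generating function of the p_k is 1 / (1 - t (y d + e) + y t^2),
    so p_k is the sum over a + b = k of y^a times the coefficient of t^a u^b in
    the resolvent 1 / (1 - t d - u e + t u).  D has the eigenvalues
    (1 - q^j)/(1 - q) on the span of the E^i v0, and <W| takes the value 1 on suitably normalized
    eigenvectors v_j.  In this basis the equation for the resolvent applied to
    v0 couples only v_j and v_(j-1), so its solution is a product of a function
    of t and a function of u.  The sum over j telescopes and gives
    (-1)^(a+b) q^((a+1) b) for the coefficient of t^a u^b ([W_mixed]).

    The given |V> satisfies D|V> = |V> instead.  But one may adjoin to the space
    a vacuum v0 with D v0 = 0, E v0 = |V> and <W|v0> = 1: all relations persist,
    and (yD + E) v0 = |V>.  So the wanted scalar, with exponent n - 1, is the
    vacuum scalar with exponent n ([iter_vacuum]).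

    Finally y <W|p_k|v0> and the k-th term of the theorem are almost the same
    sum: one has the term i = k + 1, the other the term i = 0.  The difference
    is (1 - y) p_k(0) ([W_chebyshev]), and it contributes (1 - y) 0^n = 0 in
    total ([sum_ballot_chebyshev_at0]). *)

(** * Weighted Motzkin paths *)

Section BallotPaths.

Variables (K : fieldType) (y : K).

(** The Lindstroem-Gessel-Viennot determinant for two non-crossing paths with n
    steps each: the first makes j up-steps and the second j + k.  Integer
    indices let the recurrence [path_pairsS] hold with no boundary case. *)
Definition path_pairs (n : nat) (j k : int) : K :=
  (binz n j)%:R * (binz n (j + k))%:R
  - (binz n (j - 1))%:R * (binz n (j + k + 1))%:R.

(** Total weight of the Motzkin paths with n steps from height 0 to height k;
    up-steps weigh 1, level steps 1 + y, down-steps y.  The height is the distance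
    between the two paths of a pair, and y marks the up-steps of the first. *)
Definition ballot (n k : nat) : K :=
  \sum_(0 <= j < (n - k).+1) y ^+ j * path_pairs n j k.

Lemma binz_pascal n z : binz n.+1 z = (binz n z + binz n (z - 1))%N.
Proof.
case: z => [[|m]|m] //; first by rewrite /= !bin0.
by rewrite -[X in X - 1]natz mulrSr natz addrK /= binS.
Qed.

Lemma binz_small n z : (n%:Z < z)%R -> binz n z = 0%N.
Proof. by case: z => // m; rewrite ltz_nat => ltnm; rewrite /= bin_small. Qed.

Lemma path_pairsS n j k :
  path_pairs n.+1 j k = path_pairs n j (k - 1) + path_pairs n j k
                        + path_pairs n (j - 1) k + path_pairs n (j - 1) (k + 1).
Proof.
rewrite /path_pairs !binz_pascal !natrD.
have -> : j + k - 1 = j + (k - 1) by ring.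
have -> : j + (k - 1) + 1 = j + k by ring.
have -> : j + k + 1 - 1 = j + k by ring.
have -> : j - 1 + k = j + (k - 1) by ring.
have -> : j + (k - 1) + 1 = j + k by ring.
have -> : j - 1 + (k + 1) = j + k by ring.
ring.
Qed.

(** Height -1 is out of reach for a non-crossing pair: the two rows of the
    determinant coincide. *)
Lemma path_pairs_below n j : path_pairs n j (-1) = 0.
Proof. by rewrite /path_pairs subrK mulrC subrr. Qed.

Lemma path_pairs_over n (j k : nat) : (n < j + k)%N -> path_pairs n j k = 0.
Proof.
move=> lt_n; have lt_nZ : n%:Z < j%:Z + k%:Z by lia.
rewrite /path_pairs (@binz_small n (j%:Z + k%:Z)) // (@binz_small n (j%:Z + k%:Z + 1)).
  by rewrite !mulr0 subrr.
lia.
Qed.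

Lemma ballot_widen n k L : (n - k < L)%N ->
  ballot n k = \sum_(0 <= j < L) y ^+ j * path_pairs n j k.
Proof.
move=> ltL; rewrite [RHS](big_cat_nat (n := (n - k).+1)) //= [X in _ + X]big1_seq ?addr0 //.
move=> j /andP[_]; rewrite mem_index_iota => /andP[lej _].
by rewrite path_pairs_over ?mulr0 //; lia.
Qed.

Lemma path_pairs_neg n k : path_pairs n (- 1) k = 0.
Proof. by rewrite /path_pairs /= !mul0r subrr. Qed.

Lemma sum_path_pairs_pred n k L :
  \sum_(0 <= j < L.+1) y ^+ j * path_pairs n (j%:Z - 1) k
  = y * \sum_(0 <= j < L) y ^+ j * path_pairs n j k.
Proof.
rewrite big_nat_recl // sub0r path_pairs_neg mulr0 add0r mulr_sumr.
by apply: eq_bigr => j _; rewrite exprS -mulrA -[j.+1]addn1 PoszD addrK.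
Qed.

Lemma ballot_step n k L : (n < L)%N ->
  ballot n.+1 k = \sum_(0 <= j < L.+1) y ^+ j * path_pairs n j (k%:Z - 1)
                  + (1 + y) * ballot n k + y * ballot n k.+1.
Proof.
move=> ltnL; rewrite (@ballot_widen _ _ L.+1); last lia.
under eq_bigr => j _.
  rewrite path_pairsS (mulrDr _ (_ + path_pairs _ _ _ + _)).
  rewrite (mulrDr _ (_ + path_pairs _ _ _)) (mulrDr _ (path_pairs _ _ _)).
over.
rewrite !big_split /= !sum_path_pairs_pred.
have -> : k%:Z + 1 = k.+1 by lia.
by rewrite -!ballot_widen; [ring | lia..].
Qed.

Lemma ballotS n k :
  ballot n.+1 k = (if k is k'.+1 then ballot n k' else 0)
                  + (1 + y) * ballot n k + y * ballot n k.+1.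
Proof.
rewrite (@ballot_step _ _ n.+1) //; congr (_ + _ + _).
case: k => [|k]; last first.
  by have -> : k.+1%:Z - 1 = k by [lia]; rewrite -ballot_widen //; lia.
by rewrite sub0r big1 // => j _; rewrite path_pairs_below mulr0.
Qed.

Lemma ballot_over n k : (n < k)%N -> ballot n k = 0.
Proof.
move=> ltnk; rewrite /ballot big1_seq // => j _.
by rewrite path_pairs_over ?mulr0 //; lia.
Qed.

Lemma ballot0 : ballot 0 0 = 1.
Proof. by rewrite /ballot big_nat1 /path_pairs /= mul1r mul0r subr0 mul1r. Qed.

(** Each application of X moves the index of P as a Motzkin step moves the
    height, so the last-step recurrence of [ballot] is all that is needed. *)
Lemma iter_ballot (U : lmodType K) (X : {linear U -> U}) (P : nat -> U) :
    (forall k, X (P k) = P k.+1 + (1 + y) *: P k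
                         + y *: (if k is k'.+1 then P k' else 0)) ->
  forall n, iter n X (P 0) = \sum_(0 <= k < n.+1) ballot n k *: P k.
Proof.
move=> XP; elim=> [|n IHn]; first by rewrite big_nat1 ballot0 scale1r.
have widen : \sum_(0 <= k < n.+2) ballot n k *: P k = \sum_(0 <= k < n.+1) ballot n k *: P k.
  by rewrite big_nat_recr //= ballot_over // scale0r addr0.
rewrite iterS IHn linear_sum /=.
under eq_bigr => k _ do rewrite linearZ /= XP !scalerDr.
under [RHS]eq_bigr => k _ do rewrite ballotS !scalerDl.
rewrite !big_split /=; congr (_ + _ + _).
- by rewrite [RHS]big_nat_recl // scale0r add0r.
- under [RHS]eq_bigr => k _ do rewrite -scalerA.
  under eq_bigr => k _ do rewrite scalerA mulrC -scalerA.
  by rewrite -!scaler_sumr widen.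
under [RHS]eq_bigr => k _ do rewrite -scalerA.
under eq_bigr => k _ do rewrite scalerA mulrC -scalerA.
rewrite -!scaler_sumr; congr (_ *: _).
rewrite big_nat_recl // scaler0 add0r !big_nat_recr //= !ballot_over ?scale0r ?addr0 //.
Qed.

End BallotPaths.

Lemma scaler_swap (R : comNzRingType) (M : lmodType R) (a b : R) (x : M) :
  a *: (b *: x) = b *: (a *: x).
Proof. by rewrite !scalerA mulrC. Qed.

(** * Coefficients of the resolvent on the q-number states *)

Section Coefficients.

Variables (K : fieldType) (q : K).
Hypothesis q_neq0 : q != 0.

(** The coefficient of t^a in
    (1-q)(1-q^2)...(1-q^j) / ((1+t)(1+tq)...(1+tq^j)). *)
Definition dcoef (j a : nat) : K :=
  (-1) ^+ a * \prod_(0 <= i < j) (1 - q ^+ (a + i).+1).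

(** The coefficient of u^b in u^j q^(-(0+1+...+(j-1))) / prod_(i <= j) (1+uq^(-i)).
    The recursion is multiplication by the last factor of the denominator. *)
Fixpoint ecoef (j b : nat) : K :=
  match b, j with
  | 0, _ => (j == 0)%:R
  | b'.+1, 0 => - ecoef 0 b'
  | b'.+1, j'.+1 => q ^- j' * ecoef j' b' - q ^- j * ecoef j b'
  end.

Lemma dcoefSl j a : dcoef j.+1 a = (1 - q ^+ (a + j).+1) * dcoef j a.
Proof. by rewrite /dcoef big_nat_recr //= mulrA mulrC. Qed.

Lemma dcoef_shift j a : (1 - q ^+ (a + j).+1) * dcoef j a = - (1 - q ^+ a.+1) * dcoef j a.+1.
Proof.
elim: j => [|j IHj]; first by rewrite /dcoef !big_geq // addn0 [(-1) ^+ a.+1]exprS; ring.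
by rewrite !dcoefSl IHj addSnnS; ring.
Qed.

Lemma dcoefSS j a :
  dcoef j.+1 a.+1 + q ^+ j.+1 * dcoef j.+1 a = (1 - q ^+ j.+1) * dcoef j a.+1.
Proof.
by rewrite !dcoefSl (dcoef_shift j a) -addnS exprD; ring.
Qed.

Lemma ecoef_small j b : (b < j)%N -> ecoef j b = 0.
Proof.
elim: b j => [|b IHb] [|j] // ltbj.
by rewrite /= !IHb ?mulr0 ?subrr // ltnW.
Qed.

(** The telescoping sum.  The summand comes from [sum_dcoef_ecoef] read as the
    claim that the sum of [dcoef * ecoef] is multiplied by - q^(a+1) when b
    increases by 1. *)
Lemma sum_dcoef_ecoef_trunc a b N :
  \sum_(0 <= j < N.+1) dcoef j a * (ecoef j b.+1 + q ^+ a.+1 * ecoef j b)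
  = - (q ^- N * dcoef N.+1 a * ecoef N b).
Proof.
elim: N => [|N IHN].
  by rewrite big_nat1 dcoefSl addn0 /= expr0 invr1; ring.
rewrite big_nat_recr //= IHN [dcoef N.+2 a]dcoefSl.
rewrite -addSn (exprD q a.+1) /=.
have := expf_neq0 N.+1 q_neq0; move: (q ^+ N.+1) (q ^- N) => Q q' Q0.
by field.
Qed.

Lemma sum_dcoef_ecoef a b :
  \sum_(0 <= j < b.+1) dcoef j a * ecoef j b = (-1) ^+ (a + b) * q ^+ (a.+1 * b).
Proof.
elim: b => [|b IHb].
  by rewrite big_nat1 /dcoef big_geq // muln0 addn0 !mulr1.
rewrite mulnS (exprD q) addnS exprS mulrACA -IHb; apply/eqP.
rewrite mulN1r mulNr -addr_eq0 mulr_sumr.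
have -> : \sum_(0 <= j < b.+1) q ^+ a.+1 * (dcoef j a * ecoef j b)
  = \sum_(0 <= j < b.+2) q ^+ a.+1 * (dcoef j a * ecoef j b).
  by rewrite [RHS]big_nat_recr //= ecoef_small // !mulr0 addr0.
rewrite -big_split /=; under eq_bigr => j _ do rewrite mulrCA -mulrDr.
by rewrite sum_dcoef_ecoef_trunc ecoef_small // mulr0 oppr0.
Qed.

End Coefficients.

(** * Chebyshev polynomials of yD + E applied to the vacuum *)

Section Expansion.

Variables (K : fieldType) (q : K) (U : lmodType K) (D E : {linear U -> U}).
Variable v : nat -> U.
Hypothesis q_neq0 : q != 0.
Hypothesis Dv : forall j, (1 - q) *: D (v j) = (1 - q ^+ j) *: v j.
Hypothesis Ev : forall j, (1 - q) *: E (v j)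
   = q ^- j *: ((1 - q ^+ j.+1) *: v j.+1 - (1 - q ^+ j) *: v j).

Definition Dhat (x : U) := (1 - q) *: D x - x.
Definition Ehat (x : U) := (1 - q) *: E x - x.

(** The coefficient of t^a u^b in (1 - t d - u e + t u)^(-1) v_0, where d = [Dhat]
    and e = [Ehat], written on the eigenvectors v_j of d.  The lemmas
    [Dhat_mixed0], [Ehat_mixed0] and [Ehat_mixedS] are the equations that
    characterize this resolvent. *)
Definition mixed (a b : nat) : U :=
  \sum_(0 <= j < b.+1) (dcoef q j a * ecoef q j b) *: v j.

Lemma mixed_widen a b : mixed a b = \sum_(0 <= j < b.+2) (dcoef q j a * ecoef q j b) *: v j.
Proof. by rewrite [RHS]big_nat_recr //= ecoef_small // mulr0 scale0r addr0. Qed.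

Lemma mixed0 a : mixed a 0 = (-1) ^+ a *: v 0.
Proof. by rewrite /mixed big_nat1 /dcoef big_geq // !mulr1. Qed.

Lemma Dhat_mixed a b :
  Dhat (mixed a b) = \sum_(0 <= j < b.+1) (- q ^+ j * (dcoef q j a * ecoef q j b)) *: v j.
Proof.
rewrite /Dhat /mixed linear_sum scaler_sumr -sumrB; apply: eq_bigr => j _.
rewrite linearZ /= scaler_swap Dv scalerA -scalerBl; congr (_ *: _).
ring.
Qed.

(** The image is arranged so that the coefficient of v_j shows the left-hand
    side of the recursion of [ecoef].  At j = 0 the predecessor j.-1 is harmless,
    since 1 - q^0 = 0. *)
Lemma Ehat_mixed a b :
  Ehat (mixed a b) =
  \sum_(0 <= j < b.+2)
    ((1 - q ^+ j) * dcoef q j.-1 a * (ecoef q j b.+1 + q ^- j * ecoef q j b)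
     - q ^- j * dcoef q j a * ecoef q j b) *: v j.
Proof.
under [RHS]eq_bigr => j _ do rewrite scalerBl.
rewrite sumrB big_nat_recl // expr0 subrr !mul0r scale0r add0r.
rewrite [X in _ - X]big_nat_recr //= ecoef_small // mulr0 scale0r addr0 -sumrB.
rewrite /Ehat /mixed linear_sum scaler_sumr -sumrB; apply: eq_bigr => j _.
rewrite linearZ /= scaler_swap Ev scalerBr !scalerA scalerBr !scalerA.
rewrite -addrA -opprD -scalerDl; congr (_ *: _ - _ *: _); last first.
   by have := expf_neq0 j q_neq0; move: (q ^+ j) => Q Q0; field.
by rewrite subrK; ring.
Qed.

Lemma Ehat_mixed0 b : Ehat (mixed 0 b) = mixed 0 b.+1.
Proof.
rewrite Ehat_mixed; apply: eq_bigr => -[|j] _; congr (_ *: _).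
  by rewrite /= expr0 invr1; ring.
have -> : (1 - q ^+ j.+1) * dcoef q j.+1.-1 0 = dcoef q j.+1 0 by rewrite dcoefSl.
ring.
Qed.

Lemma Ehat_mixedS a b :
  Ehat (mixed a.+1 b) = mixed a.+1 b.+1 - Dhat (mixed a b.+1) + mixed a b.
Proof.
rewrite Ehat_mixed (mixed_widen a b) Dhat_mixed -sumrB -big_split /=.
apply: eq_bigr => j _; rewrite -scalerBl -scalerDl; congr (_ *: _).
case: j => [|j].
  by rewrite /= expr0 /dcoef !big_geq // invr1 [(-1) ^+ a.+1]exprS; ring.
rewrite succnK -dcoefSS.
have := expf_neq0 j.+1 q_neq0; move: (q ^+ j.+1) (q ^- j) => Q q' Q0.
by field.
Qed.

Lemma Dhat_mixed0 a : Dhat (mixed a 0) = mixed a.+1 0.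
Proof.
rewrite Dhat_mixed big_nat1 mixed0 /dcoef big_geq //; congr (_ *: _).
by rewrite /= exprS; ring.
Qed.

Variable y : K.

(** p_k(x) v_0: the substitution t := y t, u := t turns the denominator of the
    resolvent into 1 - t (y d + e) + y t^2, the one of the Chebyshev-like
    polynomials. *)
Definition chebyshev (k : nat) : U :=
  \sum_(0 <= a < k.+1) y ^+ a *: mixed a (k - a).

Lemma chebyshev_step k :
  (1 - q) *: (y *: D (chebyshev k) + E (chebyshev k))
  = chebyshev k.+1 + (1 + y) *: chebyshev k
    + y *: (if k is k'.+1 then chebyshev k' else 0).
Proof.
have DhatE : Dhat (chebyshev k) = \sum_(0 <= a < k.+1) y ^+ a *: Dhat (mixed a (k - a)).
  rewrite /Dhat /chebyshev linear_sum scaler_sumr -sumrB; apply: eq_bigr => a _.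
  by rewrite linearZ /= scaler_swap -scalerBr.
have EhatE : Ehat (chebyshev k) = \sum_(0 <= a < k.+1) y ^+ a *: Ehat (mixed a (k - a)).
  rewrite /Ehat /chebyshev linear_sum scaler_sumr -sumrB; apply: eq_bigr => a _.
  by rewrite linearZ /= scaler_swap -scalerBr.
have -> : (1 - q) *: (y *: D (chebyshev k) + E (chebyshev k))
   = y *: Dhat (chebyshev k) + Ehat (chebyshev k) + (1 + y) *: chebyshev k.
  rewrite /Dhat /Ehat scalerDr scaler_swap.
  set d := (1 - q) *: D _; set e := (1 - q) *: E _; set p := chebyshev k.
  by rewrite scalerBr scalerDl scale1r (addrACA (y *: d)) -opprD (addrC p) subrK.
rewrite [RHS]addrAC; congr (_ + _); rewrite DhatE EhatE.
case: k {DhatE EhatE} => [|k].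
  rewrite scaler0 addr0 !big_nat1 /chebyshev /= subnn Dhat_mixed0 Ehat_mixed0.
  by rewrite big_nat_recr //= big_nat1 addrC !expr1 !scale1r.
rewrite big_nat_recr //= subnn Dhat_mixed0.
rewrite [X in _ + X]big_nat_recl // subn0 Ehat_mixed0 scale1r.
under [X in _ + (_ + X)]eq_big_nat => a /andP[_ lt_a].
  rewrite subSS Ehat_mixedS -subSn // scalerDr scalerBr.
over.
rewrite !big_split /= sumrN.
have shiftE (F : nat -> U) : \sum_(0 <= a < k.+1) y ^+ a.+1 *: F a
    = y *: \sum_(0 <= a < k.+1) y ^+ a *: F a.
  by rewrite scaler_sumr; apply: eq_bigr => a _; rewrite scalerA -exprS.
rewrite /chebyshev !shiftE [in RHS]big_nat_recr //= subnn.
rewrite [\sum_(0 <= i < k.+2) _]big_nat_recl // subn0 scale1r.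
under [\sum_(0 <= i < k.+1) y ^+ i.+1 *: mixed i.+1 (k.+2 - i.+1)]eq_bigr => i _ do rewrite subSS.
rewrite scalerDr scalerA -exprS.
set x := y *: _; set z := y ^+ k.+2 *: _.
rewrite [x + z]addrC -!addrA ![x + (_ + _)]addrCA addKr.
by rewrite (shiftE (fun i => mixed i.+1 (k.+1 - i))) [LHS]addrCA [z + _]addrCA.
Qed.

End Expansion.

(** * The states generated from a vacuum killed by D *)

Section QNumberStates.

Variables (K : fieldType) (q : K) (U : lmodType K) (D E : {linear U -> U}).
Hypothesis q_neq0 : q != 0.
Hypothesis q_not_root : forall j, (0 < j)%N -> 1 - q ^+ j != 0.
Hypothesis DE_comm : forall x, D (E x) = q *: E (D x) + D x + E x.
Variable v0 : U.
Hypothesis D_v0 : D v0 = 0.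

(** Normalized so that W is 1 on every state; this is where q must not be a root
    of unity. *)
Fixpoint state (j : nat) : U :=
  if j is j'.+1 then
    (1 - q ^+ j)^-1 *:
      (q ^+ j' *: ((1 - q) *: E (state j')) + (1 - q ^+ j') *: state j')
  else v0.

Lemma E_state j : (1 - q) *: E (state j)
  = q ^- j *: ((1 - q ^+ j.+1) *: state j.+1 - (1 - q ^+ j) *: state j).
Proof.
rewrite [state j.+1]/= scalerA mulfV ?q_not_root // scale1r addrK scalerA.
by rewrite mulVf ?scale1r // expf_neq0.
Qed.

(** E alone does not preserve eigenvectors of D, but by the commutation relation
    it maps the j-th one to a combination of the j-th and the next one, and the
    definition of [state] removes the former. *)
Lemma D_state j : (1 - q) *: D (state j) = (1 - q ^+ j) *: state j.
Proof.
elim: j => [|j IHj]; first by rewrite /= D_v0 expr0 subrr scale0r scaler0.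
rewrite /= linearZ linearD /= !linearZ /=; congr (_ *: _).
have DE_state : (1 - q) *: D (E (state j))
    = (1 - q ^+ j.+1) *: E (state j) + (1 - q ^+ j) *: state j.
  have ED_state : (1 - q) *: E (D (state j)) = (1 - q ^+ j) *: E (state j).
    by have := congr1 E IHj; rewrite !linearZ.
  rewrite DE_comm !scalerDr IHj scaler_swap ED_state scalerA.
  by rewrite addrAC -scalerDl exprS; congr (_ *: _ + _); ring.
rewrite DE_state [LHS]scalerDr (scaler_swap _ (1 - q ^+ j)) IHj.
rewrite !scalerDr !scalerA -addrA -scalerDl; congr (_ *: _ + _ *: _); first ring.
by rewrite exprS; ring.
Qed.

Variable W : {linear U -> K^o}.
Hypothesis W_E : forall x, W (E x) = W x.
Hypothesis W_v0 : W v0 = 1.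

Lemma W_state j : W (state j) = 1.
Proof.
elim: j => // j IHj; rewrite /= linearZ linearD /= !linearZ /= W_E IHj.
rewrite /GRing.scale /= !mulr1 -[RHS](mulVf (q_not_root (ltn0Sn j))); congr (_ * _).
by rewrite exprS; ring.
Qed.

Lemma W_mixed a b : W (mixed q state a b) = (-1) ^+ (a + b) * q ^+ (a.+1 * b).
Proof.
rewrite /mixed linear_sum -sum_dcoef_ecoef //; apply: eq_bigr => j _.
by rewrite linearZ /= W_state /GRing.scale /= mulr1.
Qed.

Variable y : K.

(** p_k(0), where p_k is the Chebyshev-like polynomial of x. *)
Definition chebyshev_at0 (k : nat) : K := (-1) ^+ k * \sum_(0 <= i < k.+1) y ^+ i.

(** This is the expansion of x^n on the p_k, evaluated at x = 0. *)
Lemma sum_ballot_chebyshev_at0 n : (0 < n)%N ->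
  \sum_(0 <= k < n.+1) ballot y n k * chebyshev_at0 k = 0.
Proof.
case: n => // n _.
have step k : (\0 : {linear K^o -> K^o}) (chebyshev_at0 k)
    = chebyshev_at0 k.+1 + (1 + y) *: (chebyshev_at0 k : K^o)
    + y *: (if k is k'.+1 then chebyshev_at0 k' else 0 : K^o).
  rewrite /GRing.scale /= /chebyshev_at0.
  case: k => [|k]; first by rewrite !big_nat_recr //= !big_geq //; ring.
  by rewrite !(big_nat_recr k.+2) //= !(big_nat_recr k.+1) //= !exprS; ring.
have := iter_ballot step n.+1; rewrite iterS /= => H.
by rewrite /GRing.scale /= in H; rewrite -H.
Qed.

Definition theta (k : nat) : K :=
  \sum_(0 <= i < k.+1) y ^+ i * q ^+ (i * (k + 1 - i)).

(** With i = a + 1, the left-hand side is the sum defining [theta], over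
    1 <= i <= k + 1 instead of 0 <= i <= k, up to the sign (-1)^k.  The end terms
    1 and y^(k+1) differ by (1 - y)(1 + y + ... + y^k). *)
Lemma W_chebyshev k :
  y * W (chebyshev q state y k) = (-1) ^+ k * theta k - (1 - y) * chebyshev_at0 k.
Proof.
have -> : W (chebyshev q state y k)
   = (-1) ^+ k * \sum_(0 <= a < k.+1) y ^+ a * q ^+ (a.+1 * (k - a)).
  rewrite /chebyshev linear_sum mulr_sumr; apply: eq_big_nat => a /andP[_ lt_a].
  by rewrite linearZ /= W_mixed subnKC // /GRing.scale /= mulrCA.
rewrite /chebyshev_at0 (mulrCA y) (mulrCA (1 - y)) -mulrBr; congr (_ * _).
rewrite -[1 - y]opprB mulNr opprK.
have -> : (y - 1) * \sum_(0 <= i < k.+1) y ^+ i = y ^+ k.+1 - 1.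
  by rewrite subrX1 big_mkord.
rewrite /theta [in RHS]big_nat_recl // big_nat_recr //= subnn muln0 mul0n !mulr1.
rewrite mulrDr -exprS mulr_sumr [RHS]addrC addrA subrK [RHS]addrC; congr (_ + _).
by apply: eq_bigr => i _; rewrite exprS -mulrA addn1 subSS.
Qed.

(** The theorem for the vacuum: the sum over the Chebyshev-like basis is taken
    once for x and once for the number 0. *)
Lemma vacuum_formula n : (0 < n)%N ->
  y * (1 - q) ^+ n * W (iter n (y \*: D \+ E) v0)
  = \sum_(0 <= k < n.+1) (-1) ^+ k * ballot y n k * theta k.
Proof.
move=> n_gt0.
pose X : {linear U -> U} := (1 - q) \*: (y \*: D \+ E).
have X_P k := chebyshev_step q_neq0 D_state E_state y k.
have iterX m : iter m X v0 = (1 - q) ^+ m *: iter m (y \*: D \+ E) v0.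
  elim: m => [|m IHm]; first by rewrite scale1r.
  by rewrite !iterS IHm linearZ /= scalerA exprSr.
have P0 : chebyshev q state y 0 = v0.
  by rewrite /chebyshev big_nat1 mixed0 !scale1r.
have := @iter_ballot _ y _ X _ X_P n; rewrite P0 iterX => /(congr1 W).
rewrite linearZ linear_sum /= {1}/GRing.scale /= => H.
have at0 : 0 = \sum_(0 <= k < n.+1) (1 - y) * (ballot y n k * chebyshev_at0 k).
  by rewrite -mulr_sumr sum_ballot_chebyshev_at0 // mulr0.
rewrite -mulrA H mulr_sumr -[RHS]subr0 [X in _ - X]at0 -sumrB; apply: eq_bigr => k _.
by rewrite linearZ /= {1}/GRing.scale /= mulrCA W_chebyshev; ring.
Qed.

End QNumberStates.

(** * Adjoining a vacuum *)

Section AdjoinVacuum.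

Variables (K : fieldType) (U : lmodType K) (D E : {linear U -> U}).
Variables (W : {linear U -> K^o}) (V : U).

Local Notation U0 := (K^o * U)%type.

(** The pair (1, 0) is the new vacuum: D kills it and E maps it to V. *)
Definition D_ext (x : U0) : U0 := (0, D x.2).
Definition E_ext (x : U0) : U0 := (0, E x.2 + x.1 *: V).
Definition W_ext (x : U0) : K^o := x.1 + W x.2.

Fact D_ext_linear : linear D_ext.
Proof. by move=> a x z; rewrite /D_ext linearP; congr (_, _); rewrite /= scaler0 addr0. Qed.
HB.instance Definition _ := GRing.isLinear.Build K U0 U0 *:%R D_ext D_ext_linear.

Fact E_ext_linear : linear E_ext.
Proof.
move=> a x z; rewrite /E_ext linearP; congr (_, _); rewrite /= ?scaler0 ?addr0 //.
by rewrite scalerDl scalerDr scalerA addrACA.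
Qed.
HB.instance Definition _ := GRing.isLinear.Build K U0 U0 *:%R E_ext E_ext_linear.

Fact W_ext_linear : linear W_ext.
Proof. by move=> a x z; rewrite /W_ext /= linearP /= scalerDr addrACA. Qed.
HB.instance Definition _ := GRing.isLinear.Build K U0 K^o *:%R W_ext W_ext_linear.

Lemma iter_vacuum y n :
  iter n.+1 (y \*: D_ext \+ E_ext) (1, 0) = (0, iter n (y \*: D \+ E) V).
Proof.
elim: n => [|n IHn].
  congr (_, _); rewrite /= ?scaler0 ?addr0 //.
  by rewrite !linear0 scale1r !add0r.
rewrite iterS IHn [in RHS]iterS.
by congr (_, _); rewrite /= ?scale0r ?scaler0 addr0.
Qed.

End AdjoinVacuum.

(** * The formula *)

Lemma indet_q_not_root j : (0 < j)%N -> indet_q ^+ j != 1.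
Proof.
move=> j_gt0; rewrite /indet_q -tofracXn -tofrac1 tofrac_eq.
rewrite -rmorphXn -polyC1 (inj_eq (@polyC_inj _)).
apply/eqP => /(congr1 (fun p : {poly rat} => size p)).
by rewrite size_polyXn size_poly1; case: j j_gt0.
Qed.

Theorem theorem1
  (K : fieldType) (iota : {rmorphism ratfun_qy -> K})
  (q := iota indet_q) (y := iota indet_y)
  (U : lmodType K) (D E : {linear U -> U})
  (W : {linear U -> K^o}) (V : U)
  (hDE : (D \o E) \- q \*: (E \o D) =1 D \+ E)
  (hWE : W \o E =1 W)
  (hDV : D V = V)
  (hWV : W V = 1)
  (n : nat) (hn : (0 < n)%N) :
  W (iter n.-1 (y \*: D \+ E) V) =
    1 / (y * (1 - q) ^+ n) *
    \sum_(0 <= k < n.+1)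
      (-1) ^+ k *
      (\sum_(0 <= j < (n - k).+1)
         y ^+ j * ((binz n j)%:R * (binz n (j%:Z + k%:Z))%:R
                   - (binz n (j%:Z - 1))%:R * (binz n (j%:Z + k%:Z + 1))%:R)) *
      (\sum_(0 <= i < k.+1) y ^+ i * q ^+ (i * (k + 1 - i))%N).
Proof.
have q_not_root j : (0 < j)%N -> 1 - q ^+ j != 0.
  move=> /indet_q_not_root; apply: contraNneq => /eqP.
  by rewrite subr_eq0 eq_sym -rmorphXn fmorph_eq1.
have q_neq0 : q != 0 by rewrite fmorph_eq0 tofrac_eq0 polyC_eq0 polyX_eq0.
have y_neq0 : y != 0 by rewrite fmorph_eq0 tofrac_eq0 polyX_eq0.
have DE_comm x : D (E x) = q *: E (D x) + D x + E x.
  by have /eqP := hDE x; rewrite subr_eq addrC addrA => /eqP.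
have D_ext_comm x : D_ext D (E_ext E V x) = q *: E_ext E V (D_ext D x) + D_ext D x + E_ext E V x.
  congr (_, _); rewrite /= ?scaler0 ?addr0 //.
  by rewrite linearD linearZ /= hDV scale0r addr0 DE_comm addrA.
have D_ext_vac : D_ext D (1, 0) = 0 by rewrite /D_ext linear0.
have W_E_ext x : W_ext W (E_ext E V x) = W_ext W x.
  rewrite /W_ext /= linearD linearZ /= hWV add0r addrC.
  by have /= -> := hWE x.2; rewrite /GRing.scale /= mulr1.
have W_ext_vac : W_ext W (1, 0) = 1 by rewrite /W_ext linear0 addr0.
have := vacuum_formula q_neq0 q_not_root D_ext_comm D_ext_vac W_E_ext W_ext_vac y hn.
have := iter_vacuum D E V y n.-1; rewrite prednK // => ->.
rewrite [X in _ * X = _ -> _]add0r => H.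
have denom_neq0 : y * (1 - q) ^+ n != 0.
  by rewrite mulf_neq0 // expf_neq0 // -[q]expr1 q_not_root.
by rewrite mul1r; apply: (canRL (mulKf denom_neq0)); exact: H.
Qed.
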